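(* Let $(A,\cdot)$ be an algebra. If $(A,\cdot)$ is an $\mathcal{A}$flexible $\mathcal{A}\mathrm{BD}$-algebra, then $(A,\cdot)$ is an $\mathcal{A}\mathrm{BD}$-extension of the quotient Jacobi-Jordan algebra $A^+/(A^-)^2$.
   Context: All algebras are over $\mathbb{C}$; an algebra $(A,\cdot)$ is a vector space with a bilinear (not necessarily associative) multiplication. Write $x\circ y = x\cdot y+y\cdot x$, $[x,y]=x\cdot y-y\cdot x$, $A^+=(A,\circ)$, $A^-=(A,[\cdot,\cdot])$; $(A^-)^2$ is the linear span of all $[x,y]$. With $\mathcal{A}(x,y,z)=(x\cdot y)\cdot z+x\cdot(y\cdot z)$, the algebra is $\mathcal{A}$flexible if $\mathcal{A}(x,y,z)=\mathcal{A}(z,y,x)$ for all $x,y,z$. A Jacobi-Jordan algebra is a commutative algebra satisfying $x(yz)+y(zx)+z(xy)=0$. An algebra $(A,\cdot)$ is called an $\mathcal{A}\mathrm{BD}$-algebra if for all $x,y,z\in A$: $x\cdot(y\circ z) = -\big((x\cdot y)\circ z+y\circ(x\cdot z)\big)$ and $(y\circ z)\cdot x=-\big((y\cdot x)\circ z+y\circ(z\cdot x)\big)$. $\mathcal{A}\mathrm{BD}$-extension: let $(V,\circ_V)$ be a Jacobi-Jordan algebra, $H$ a vector space (a trivial $V$-module), and $\beta:V\times V\to H$ a $2$-cocycle, i.e. a symmetric bilinear map with $\beta(x\circ_V y,z)+\beta(y\circ_V z,x)+\beta(z\circ_V x,y)=0$. Equip $V\oplus H$ with the central extension product $(x+a)\circ(y+b)=x\circ_V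 y+\beta(x,y)$ ($x,y\in V$, $a,b\in H$), and let $[\cdot,\cdot]:(V\oplus H)\times(V\oplus H)\to H$ be an anti-symmetric bilinear map such that $[x\circ_V y+\beta(x,y),\,z+c]=0$ for all $x,y,z\in V$, $c\in H$. Then $V\oplus H$ with product $X\cdot Y=\tfrac12\big([X,Y]+X\circ Y\big)$ is called an $\mathcal{A}\mathrm{BD}$-extension of $(V,\circ_V)$ (by means of $(\beta,[\cdot,\cdot])$). An algebra ''is an $\mathcal{A}\mathrm{BD}$-extension of $(V,\circ_V)$'' if it is isomorphic to one of this form. *)

(* Defs.v *)
From HB Require Import structures.
From mathcomp Require Import all_boot all_algebra sesquilinear ring_quotient.
From mathcomp Require Import boolp.

Set Implicit Arguments.
Unset Strict Implicit.
Unset Printing Implicit Defensive.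
Import GRing.Theory.
Local Open Scope ring_scope.
Local Open Scope quotient_scope.

(* An algebra is an [lmodType], of arbitrary dimension, together with a bilinear
   product; neither associativity nor a unit is assumed. *)
Section Identities.
Variables (K : fieldType) (A : lmodType K) (mul : A -> A -> A).

(* The products of A^+ and A^-. *)
Definition jprod (x y : A) : A := mul x y + mul y x.

Definition comm (x y : A) : A := mul x y - mul y x.

Definition antiassociator (x y z : A) : A := mul (mul x y) z + mul x (mul y z).

Definition Aflexible : Prop :=
  forall x y z, antiassociator x y z = antiassociator z y x.

Definition ABD_algebra : Prop :=
  (forall x y z, mul x (jprod y z) = - (jprod (mul x y) z + jprod y (mul x z)))
  /\
  (forall x y z, mul (jprod y z) x = - (jprod (mul y x) z + jprod y (mul z x))).

Definition jacobi_jordan : Prop :=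
  commutative mul /\
  forall x y z, mul x (mul y z) + mul y (mul z x) + mul z (mul x y) = 0.

End Identities.

Section JprodBilinear.
Variables (K : fieldType) (A : lmodType K) (mul : {bilinear A -> A -> A}).

Lemma jprod_bilinear : bilinear_for *:%R *:%R (jprod mul).
Proof.
by split=> u a x y; rewrite /jprod linearPl linearPr addrACA /= scalerDr.
Qed.

HB.instance Definition _ :=
  bilinear_isBilinear.Build K A A A _ _ (jprod mul) jprod_bilinear.

End JprodBilinear.

Section Span.
Variables (K : fieldType) (A : lmodType K).

Definition lspan (G : A -> Prop) : {pred A} := fun a =>
  `[< exists (n : nat) (c : 'I_n -> K) (g : 'I_n -> A),
        (forall i, G (g i)) /\ a = \sum_(i < n) c i *: g i >].

Lemma lspan_submod_closed G : submod_closed (lspan G).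
Proof.
split.
  by apply/asboolP; exists 0, (fun=> 0), (fun=> 0); split; [case | rewrite big_ord0].
move=> k u v /asboolP[m [c [g [Gg ->]]]] /asboolP[n [d [h [Gh ->]]]].
apply/asboolP; exists (m + n)%N.
exists (fun i => match split i with inl j => k * c j | inr j => d j end).
exists (fun i => match split i with inl j => g j | inr j => h j end).
split=> [i|]; first by case: (split i).
rewrite big_split_ord scaler_sumr; congr (_ + _); apply: eq_bigr => i _.
  by rewrite -[lshift n i]/(unsplit (inl i)) unsplitK scalerA.
by rewrite -[rshift m i]/(unsplit (inr i)) unsplitK.
Qed.

HB.instance Definition _ G :=
  GRing.isSubmodClosed.Build K A (lspan G) (lspan_submod_closed G).

End Span.

(* The subspace (A^-)^2. *)
Definition comm_span (K : fieldType) (A : lmodType K) (mul : A -> A -> A) :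
    submodClosed A :=
  lspan (fun a => exists x y, a = comm mul x y).

(* [ring_quotient] provides quotients of additive groups and rings; here the quotient
   by a subspace receives its scaling. *)
Section QuotientSpace.
Variables (K : fieldType) (A : lmodType K) (I : submodClosed A).

(* [submodClosed] is stated over semirings and does not inherit from [zmodClosed]. *)
Definition submod_zmodClosed : zmodClosed A :=
  HB.pack (GRing.SubmodClosed.sort I)
    (GRing.isZmodClosed.Build A (GRing.SubmodClosed.sort I)
      (GRing.submod_closedB (submodClosedP I))).

Definition quot_space : Type := Quotient.quot submod_zmodClosed.

HB.instance Definition _ := GRing.Zmodule.on quot_space.

Definition quot_proj (x : A) : quot_space := \pi_(Quotient.quot submod_zmodClosed) x.

Definition quot_repr (u : quot_space) : A := repr (u : Quotient.quot submod_zmodClosed).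

Lemma quot_reprK : cancel quot_repr quot_proj.
Proof. exact: reprK. Qed.

Lemma quot_projP x y : (quot_proj x = quot_proj y) <-> (x - y \in I).
Proof.
by rewrite -[x - y \in I]/(x - y \in submod_zmodClosed) Quotient.idealrBE;
  split=> [e|/eqP//]; apply/eqP.
Qed.

Lemma quot_projD : {morph quot_proj : x y / x + y}.
Proof. exact: Quotient.pi_add. Qed.

Definition quot_scale (a : K) (u : quot_space) : quot_space :=
  quot_proj (a *: quot_repr u).

Lemma quot_projZ a x : quot_scale a (quot_proj x) = quot_proj (a *: x).
Proof.
apply/quot_projP; rewrite -scalerBr rpredZ //.
by apply/quot_projP; rewrite quot_reprK.
Qed.

Fact quot_scalerA a b u : quot_scale a (quot_scale b u) = quot_scale (a * b) u.
Proof. by rewrite -[u]quot_reprK !quot_projZ scalerA. Qed.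

Fact quot_scale1r : left_id 1 quot_scale.
Proof. by move=> u; rewrite -[u]quot_reprK quot_projZ scale1r. Qed.

Fact quot_scalerDr : right_distributive quot_scale +%R.
Proof.
move=> a u v; rewrite -[u]quot_reprK -[v]quot_reprK -quot_projD.
by rewrite !quot_projZ scalerDr quot_projD.
Qed.

Fact quot_scalerDl u : {morph quot_scale^~ u : a b / a + b}.
Proof.
by move=> a b; rewrite -[u]quot_reprK !quot_projZ scalerDl quot_projD.
Qed.

HB.instance Definition _ := GRing.Zmodule_isLmodule.Build K quot_space
  quot_scalerA quot_scale1r quot_scalerDr quot_scalerDl.

Fact quot_proj_linear : linear quot_proj.
Proof. by move=> a x y; rewrite quot_projD -quot_projZ. Qed.

HB.instance Definition _ :=
  GRing.isLinear.Build K A quot_space _ quot_proj quot_proj_linear.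

End QuotientSpace.

Definition two_sided_ideal (K : fieldType) (A : lmodType K) (mul : A -> A -> A)
    (I : submodClosed A) : Prop :=
  forall a x, a \in I -> mul a x \in I /\ mul x a \in I.

Section QuotientAlgebra.
Variables (K : fieldType) (A : lmodType K) (mul : {bilinear A -> A -> A}).
Variables (I : submodClosed A) (hI : two_sided_ideal mul I).

(* [hI] is not used computationally: it makes the product independent of the
   chosen representatives, see [quot_mul_proj]. *)
Definition quot_mul of two_sided_ideal mul I := fun u v : quot_space I =>
  quot_proj I (mul (quot_repr u) (quot_repr v)).

Lemma quot_mul_proj x y :
  quot_mul hI (quot_proj I x) (quot_proj I y) = quot_proj I (mul x y).
Proof.
have rI z : quot_repr (quot_proj I z) - z \in I.
  by apply/quot_projP; rewrite quot_reprK.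
apply/quot_projP; set x' := quot_repr _; set y' := quot_repr _.
have -> : mul x' y' - mul x y = mul (x' - x) y' + mul x (y' - y).
  by rewrite linearBl linearBr addrA subrK.
by apply: rpredD; [case: (hI y' (rI x)) | case: (hI x (rI y))].
Qed.

Lemma quot_mul_bilinear : bilinear_for *:%R *:%R (quot_mul hI).
Proof.
split=> u a v w; rewrite -[u]quot_reprK -[v]quot_reprK -[w]quot_reprK.
  by rewrite -linearP !quot_mul_proj linearPl linearP.
by rewrite -linearP !quot_mul_proj linearPr linearP.
Qed.

HB.instance Definition _ := bilinear_isBilinear.Build K (quot_space I)
  (quot_space I) (quot_space I) _ _ (quot_mul hI) quot_mul_bilinear.

End QuotientAlgebra.

Section ABDExtension.
Variables (K : fieldType) (V : lmodType K) (circV : {bilinear V -> V -> V}).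

Definition JJ_cocycle (H : lmodType K) (beta : {bilinear V -> V -> H}) : Prop :=
  (forall x y, beta x y = beta y x) /\
  (forall x y z,
     beta (circV x y) z + beta (circV y z) x + beta (circV z x) y = 0).

(* In what follows the direct sum of V and H is [V * H], and the pair [(x, a)]
   stands for x + a. *)
Definition central_ext_mul (H : lmodType K) (beta : {bilinear V -> V -> H})
    (X Y : V * H) : V * H :=
  (circV X.1 Y.1, beta X.1 Y.1).

Definition ABD_bracket (H : lmodType K) (beta : {bilinear V -> V -> H})
    (br : {bilinear (V * H)%type -> (V * H)%type -> H}) : Prop :=
  (forall X Y, br X Y = - br Y X) /\
  (forall (x y z : V) (c : H), br (circV x y, beta x y) (z, c) = 0).

Definition ABD_ext_mul (H : lmodType K) (beta : {bilinear V -> V -> H})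
    (br : {bilinear (V * H)%type -> (V * H)%type -> H}) (X Y : V * H) : V * H :=
  2^-1 *: ((0, br X Y) + central_ext_mul beta X Y).

Definition is_ABD_extension (A : lmodType K) (mul : {bilinear A -> A -> A}) :
    Prop :=
  jacobi_jordan circV /\
  exists (H : lmodType K) (beta : {bilinear V -> V -> H})
         (br : {bilinear (V * H)%type -> (V * H)%type -> H}),
    [/\ JJ_cocycle beta, ABD_bracket beta br &
        exists phi : {linear A -> (V * H)%type},
          bijective phi /\
          forall x y, phi (mul x y) = ABD_ext_mul beta br (phi x) (phi y)].

End ABDExtension.

(* Main.v *)
(* With a(x,y,z) = (xy)z and b(x,y,z) = x(yz), Aflexibility makes a + b invariant under
   reversal of the arguments, and the difference of the two ABD identities makes a - b
   change sign; hence x(yz) = (zy)x.  This gives [x,y] o z = 0 and [x o y, z] = 0, so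
   I = (A^-)^2 is annihilated by A^+.  A linear section s of A -> A/I then splits A as
   A/I + I, with cocycle s(u) o s(v) - s(u o v) and bracket the commutator of A. *)

From HB Require Import structures.
Require Import Defs.
From mathcomp Require Import all_boot all_algebra sesquilinear.
From mathcomp Require Import reals complex.
From mathcomp Require Import boolp classical_sets.
Import GRing.Theory.
Local Open Scope ring_scope.

Set Implicit Arguments.
Unset Strict Implicit.
Unset Printing Implicit Defensive.

(** * Linear sections of surjective linear maps in arbitrary dimension *)

Section LinearSection.
Variables (K : fieldType) (U V : lmodType K) (f : {linear U -> V}).
Local Open Scope classical_set_scope.

(* The empty set is allowed, since it is the union of the empty chain in Zorn's lemma. *)
Definition independent_of_kernel : set (set U) := fun C =>
  (forall k u v, C u -> C v -> C (k *: u + v)) /\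
  (forall u, C u -> f u = 0 -> u = 0).

Lemma maximal_independent_of_kernel :
  exists C, independent_of_kernel C /\
    forall D, C `<` D -> ~ independent_of_kernel D.
Proof.
apply: Zorn_bigcup => F FP Ftot; split=> [k u v [C FC Cu] [D FD Dv] | u [C FC Cu]].
  have [CD|DC] := Ftot _ _ FC FD.
  - by exists D => //; apply: (FP _ FD).1 => //; apply: CD.
  - by exists C => //; apply: (FP _ FC).1 => //; apply: DC.
exact: (FP _ FC).2.
Qed.

(** A maximal [C] is a complement of the kernel: [f] restricted to [C] is bijective, and the section
    is its inverse. *)
Lemma linear_section :
  (forall v, exists u, f u = v) -> exists s : {linear V -> U}, cancel s f.
Proof.
move=> fsurj; have [C [[Clin Cker] Cmax]] := maximal_independent_of_kernel.
have maxE D : independent_of_kernel D -> C `<=` D -> D `<=` C.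
  by move=> PD CD; apply: contrapT => nDC; exact: (Cmax D).
(* Maximality excludes the empty set, since the zero subspace would extend it. *)
have C0 : C 0.
  apply: contrapT => nC0; have C_empty u : ~ C u.
    by move=> Cu; apply: nC0; have := Clin (-1) u u Cu Cu; rewrite scaleN1r addNr.
  apply: nC0; apply: (maxE [set 0]) => // [|u /C_empty//].
  by split=> [k _ _ -> -> | u -> //]; rewrite /= scaler0 addr0.
have CZ k u : C u -> C (k *: u) by move=> Cu; rewrite -[_ *: _]addr0; apply: Clin.
have CB u v : C u -> C v -> C (u - v).
  by move=> Cu Cv; rewrite addrC -scaleN1r; apply: Clin.
have Csurj v : exists u, C u /\ f u = v.
  have [x <-] := fsurj v; apply: contrapT => nx.
  (* If [f x] is not attained on [C], adjoining the line through [x] still avoids the kernel: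
     [k *: x + c] in the kernel with [k] nonzero would give [f x = f (- k^-1 *: c)]. *)
  pose D : set U := [set u | exists k c, C c /\ u = k *: x + c].
  suff Dx : C x by apply: nx; exists x.
  apply: (maxE D); first split.
  - move=> k _ _ [a [c [Cc ->]]] [b [d [Cd ->]]].
    exists (k * a + b), (k *: c + d); split; first exact: Clin.
    by rewrite scalerDr scalerA scalerDl addrACA.
  - move=> _ [k [c [Cc ->]]] fkx; have [k0|k0] := eqVneq k 0.
      by move: fkx; rewrite k0 scale0r add0r; apply: Cker.
    case: nx; exists (- k^-1 *: c); split; first exact: CZ.
    move: fkx; rewrite linearD !linearZ_LR /= => /(congr1 ( *:%R k^-1)).
    by rewrite scaler0 scalerDr scalerA mulVf // scale1r scaleNr => /eqP;
      rewrite addr_eq0 => /eqP ->.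
  - by move=> c Cc; exists 0, c; rewrite scale0r add0r.
  - by exists 1, 0; rewrite scale1r addr0.
have [s sP] := choice Csurj.
have slin : linear s.
  (* The defect of linearity lies both in [C] and in the kernel of [f], hence vanishes. *)
  move=> k u v; apply/eqP; rewrite -subr_eq0; apply/eqP/Cker.
    by apply: CB; [case: (sP (k *: u + v)) | apply: Clin; [case: (sP u) | case: (sP v)]].
  by rewrite linearB linearP /= !(proj2 (sP _)) subrr.
pose sL : {linear V -> U} := HB.pack s (GRing.isLinear.Build _ _ _ _ s slin).
by exists sL => v; case: (sP v).
Qed.

End LinearSection.

(** * Consequences of the ABD and flexibility identities *)

Section Identities.
Variables (K : fieldType) (A : lmodType K) (mul : {bilinear A -> A -> A}).
Hypothesis two_neq0 : 2 != 0 :> K.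

Lemma scaler2_inj : injective (fun u : A => u *+ 2).
Proof.
move=> u v; rewrite -!scaler_nat => /(congr1 ( *:%R 2^-1)).
by rewrite !scalerA mulVf // !scale1r.
Qed.

Lemma jprodC : commutative (jprod mul).
Proof. by move=> x y; apply: addrC. Qed.

(** Adding the two ABD identities shows that multiplication by [x] in A^+ is an antiderivation of
    A^+; by commutativity this is the Jacobi identity. *)
Lemma ABD_jacobi_jordan : ABD_algebra mul -> jacobi_jordan (jprod mul).
Proof.
case=> ABDl ABDr; split=> [|x y z]; first exact: jprodC.
have -> : jprod mul x (jprod mul y z) =
    - (jprod mul (jprod mul x y) z + jprod mul y (jprod mul x z)).
  rewrite [LHS]/jprod ABDl ABDr -opprD addrACA.
  by congr (- (_ + _)); rewrite -?linearDl -?linearDr.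
rewrite [jprod mul z (jprod _ _ _)]jprodC [jprod mul z x]jprodC.
by rewrite opprD subrK addNr.
Qed.

Hypotheses (flex : Aflexible mul) (ABD : ABD_algebra mul).

Lemma Aflexible_ABD_rev x y z : mul x (mul y z) = mul (mul z y) x.
Proof.
have [ABDl ABDr] := ABD.
(* This is the sign change of a - b. With the two antiassociators added, the left side becomes the
   left ABD identity for y(x o z), and the right side, after flexibility, the right one for (x o
   z)y; both sums are 0. *)
have eab : mul z (mul y x) + mul x (mul y z) = mul (mul x y) z + mul (mul z y) x.
  apply: (@addrI _ (antiassociator mul y x z + antiassociator mul y z x)).
  transitivity (0 : A).
    have /eqP := ABDl y x z; rewrite -addr_eq0 => /eqP <-.
    rewrite /antiassociator /jprod !(linearDl, linearDr) /=.
    by rewrite !addrA [LHS](ACl (2*4*1*5*6*3)%AC).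
  have /eqP := ABDr y x z; rewrite -addr_eq0 => /eqP <-.
  rewrite (flex y x z) (flex y z x).
  rewrite /antiassociator /jprod !(linearDl, linearDr) /=.
  by rewrite !addrA [RHS](ACl (3*1*5*2*4*6)%AC).
apply: scaler2_inj; rewrite !mulr2n.
(* The added terms are those common to both sides of the sum of [flex x y z] and [eab]; cancelling
   them leaves twice the claim. *)
apply: (@addrI _ (mul (mul x y) z + mul z (mul y x))).
have := congr2 +%R (flex x y z) eab; rewrite /antiassociator => e.
rewrite !addrA [LHS](ACl (1*3*2*4)%AC) /= -addrA e.
by rewrite !addrA [LHS](ACl (3*2*1*4)%AC).
Qed.

(** Reversal reads z(xy) = (yx)z: moving z across a product swaps its factors. So z anticommutes
    with xy - yx and, for the next lemma, commutes with xy + yx. *)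
Lemma Aflexible_ABD_jprod_comm x y z : jprod mul (comm mul x y) z = 0.
Proof.
rewrite /jprod /comm linearBl linearBr /=.
by rewrite (Aflexible_ABD_rev z x) (Aflexible_ABD_rev z y) addrA subrK subrr.
Qed.

Lemma Aflexible_ABD_comm_jprod x y z : comm mul (jprod mul x y) z = 0.
Proof.
rewrite /jprod /comm linearDl linearDr /=.
by rewrite (Aflexible_ABD_rev z x) (Aflexible_ABD_rev z y) [X in _ - X]addrC subrr.
Qed.

Lemma jprod_comm_span u x : u \in comm_span mul -> jprod mul u x = 0.
Proof.
move=> /asboolP[n [c [g [Gg ->]]]]; rewrite linear_sumlz big1 // => i _.
have [a [b ->]] := Gg i.
by rewrite linearZl_LR /= Aflexible_ABD_jprod_comm scaler0.
Qed.

End Identities.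


(** * The commutator as a bilinear map, and subspaces as vector spaces *)

Lemma comm_in_comm_span (K : fieldType) (A : lmodType K) (mul : A -> A -> A) x y :
  comm mul x y \in comm_span mul.
Proof.
apply/asboolP; exists 1, (fun=> 1), (fun=> comm mul x y).
by split; [exists x, y | rewrite big_ord1 scale1r].
Qed.

Section CommBilinear.
Variables (K : fieldType) (A : lmodType K) (mul : {bilinear A -> A -> A}).

Lemma comm_bilinear : bilinear_for *:%R *:%R (comm mul).
Proof.
by split=> u a x y; rewrite /comm linearPl linearPr opprD addrACA -scalerBr.
Qed.

HB.instance Definition _ :=
  bilinear_isBilinear.Build K A A A _ _ (comm mul) comm_bilinear.

End CommBilinear.

Section Subspace.
Variables (K : fieldType) (A : lmodType K) (I : submodClosed A).

(** The summand [H] of an extension has to be an [lmodType], so (A^-)^2 is turned into a type. *)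
Record subspace := Subspace { subspace_val :> A; _ : subspace_val \in I }.

HB.instance Definition _ := [isSub for subspace_val].
HB.instance Definition _ := [Choice of subspace by <:].
HB.instance Definition _ := [SubChoice_isSubLmodule of subspace by <:].

Lemma subspaceP (u : subspace) : val u \in I.
Proof. exact: valP. Qed.

End Subspace.

(** * The extension attached to a linear section of the quotient map *)

Section Extension.
Variables (K : fieldType) (A : lmodType K) (mul : {bilinear A -> A -> A}).
Let I := comm_span mul.
Variables (hI : two_sided_ideal (jprod mul) I).
Variables (s : {linear quot_space I -> A}) (sK : cancel s (quot_proj I)).
Let V := quot_space I.
Let H := subspace I.

Lemma ext_cocycle_subproof u v :
  jprod mul (s u) (s v) - s (quot_mul hI u v) \in I.
Proof. by apply/quot_projP; rewrite sK -quot_mul_proj !sK. Qed.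

Definition ext_cocycle (u v : V) : H := Subspace (ext_cocycle_subproof u v).

Lemma ext_cocycle_bilinear : bilinear_for *:%R *:%R ext_cocycle.
Proof.
split=> u a v w; apply: val_inj; rewrite linearP /=.
  by rewrite linearP !linearPl linearP opprD addrACA scalerBr.
by rewrite linearP !linearPr linearP opprD addrACA scalerBr.
Qed.

HB.instance Definition _ :=
  bilinear_isBilinear.Build K V V H _ _ ext_cocycle ext_cocycle_bilinear.

(** The commutator of A, transported along the inverse of [ext_iso]. *)
Definition ext_bracket (X Y : V * H) : H :=
  Subspace (comm_in_comm_span mul (s X.1 + val X.2) (s Y.1 + val Y.2)).

Lemma ext_bracket_bilinear : bilinear_for *:%R *:%R ext_bracket.
Proof.
split=> u a v w; apply: val_inj; rewrite linearP /=.
  by rewrite !linearP /= addrACA -scalerDr linearPl.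
by rewrite !linearP /= addrACA -scalerDr linearPr.
Qed.

HB.instance Definition _ := bilinear_isBilinear.Build K
  (V * H)%type (V * H)%type H _ _ ext_bracket ext_bracket_bilinear.

Lemma ext_retraction_subproof x : x - s (quot_proj I x) \in I.
Proof. by apply/quot_projP; rewrite sK. Qed.

Definition ext_iso (x : A) : V * H :=
  (quot_proj I x, Subspace (ext_retraction_subproof x)).

Lemma ext_iso_linear : linear ext_iso.
Proof.
move=> a x y; rewrite /ext_iso; congr (_, _); first exact: linearP.
by apply: val_inj; rewrite [RHS]linearP /= !linearP addrACA -scalerDr.
Qed.

HB.instance Definition _ :=
  GRing.isLinear.Build K A (V * H)%type _ ext_iso ext_iso_linear.

Lemma ext_iso_bij : bijective ext_iso.
Proof.
exists (fun X => s X.1 + val X.2) => [x | [u a]] /=; first by rewrite addrC subrK.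
have pa : quot_proj I (s u + val a) = u.
  rewrite linearD /= sK.
  suff -> : quot_proj I (val a) = quot_proj I 0 by rewrite linear0 addr0.
  by apply/quot_projP; rewrite subr0 subspaceP.
congr (_, _) => //; apply: val_inj.
by rewrite /= pa addrC addrA addNr add0r.
Qed.

Hypothesis two_neq0 : 2 != 0 :> K.
Hypotheses (flex : Aflexible mul) (ABD : ABD_algebra mul).

(** An element differs from the chosen representative of its class by an element of [I], which A^+
    annihilates. *)
Lemma jprod_section x y :
  jprod mul (s (quot_proj I x)) (s (quot_proj I y)) = jprod mul x y.
Proof.
have jI a z : a \in I -> jprod mul a z = 0.
  exact: (jprod_comm_span two_neq0 flex ABD).
have jIr a z : a \in I -> jprod mul z a = 0 by rewrite jprodC; apply: jI.
apply/eqP; rewrite eq_sym -subr_eq0.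
have -> : jprod mul x y = jprod mul (s (quot_proj I x)) y.
  apply/eqP; rewrite -subr_eq0 -linearBl /= jI //; exact: ext_retraction_subproof.
rewrite -linearBr /= jIr //; exact: ext_retraction_subproof.
Qed.

Lemma quot_jacobi_jordan : jacobi_jordan (quot_mul hI).
Proof.
have [jC jJ] := ABD_jacobi_jordan ABD.
split=> [u v | u v w]; rewrite -[u]sK -[v]sK.
  by rewrite !quot_mul_proj /= jC.
by rewrite -[w]sK !quot_mul_proj /= -!linearD /= jJ linear0.
Qed.

(** The cyclic sum is a Jacobi sum in A^+ minus the image under [s] of one in the quotient; both
    vanish. *)
Lemma ext_cocycleP : JJ_cocycle (quot_mul hI) ext_cocycle.
Proof.
have [jC jJ] := ABD_jacobi_jordan ABD; have [qC qJ] := quot_jacobi_jordan.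
split=> [u v | u v w]; apply: val_inj; first by rewrite /= jC qC.
(* Inside a product of A^+, [jprod_section] lets s(a)s(b) replace s(ab). *)
have E a b c : val (ext_cocycle (quot_mul hI a b) c) =
    jprod mul (s c) (jprod mul (s a) (s b)) - s (quot_mul hI c (quot_mul hI a b)).
  rewrite /= (qC _ c) (jC _ (s c)); congr (_ - _).
  have -> : quot_mul hI a b = quot_proj I (jprod mul (s a) (s b)).
    by rewrite -quot_mul_proj !sK.
  by rewrite -{1}[c]sK jprod_section.
transitivity (val (ext_cocycle (quot_mul hI u v) w) +
  val (ext_cocycle (quot_mul hI v w) u) +
  val (ext_cocycle (quot_mul hI w u) v)) => //.
rewrite !E [LHS](AC (2*2*2) ((1*3*5)*(2*4*6)))%AC /=.
by rewrite -!opprD -!(linearD s) jJ qJ linear0 subr0.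
Qed.

Lemma ext_bracketP : ABD_bracket (quot_mul hI) ext_cocycle ext_bracket.
Proof.
split=> [X Y | u v w c]; apply: val_inj; first by rewrite linearN /= /comm opprB.
(* The pair made of the product and the cocycle at [u], [v] stands for [jprod mul (s u) (s v)],
   whose commutators vanish. *)
rewrite /= [s _ + _]addrC subrK.
exact: Aflexible_ABD_comm_jprod.
Qed.

Lemma ext_iso_mul x y :
  ext_iso (mul x y) =
    ABD_ext_mul (quot_mul hI) ext_cocycle ext_bracket (ext_iso x) (ext_iso y).
Proof.
have -> : mul x y = 2^-1 *: (comm mul x y + jprod mul x y).
  by rewrite /comm /jprod addrACA addNr addr0 -mulr2n -scaler_nat scalerA
    mulVf // scale1r.
(* The commutator has class 0 and yields the bracket term; the A^+ product yields the central
   extension term. *)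
rewrite linearZ linearD; congr (_ *: (_ + _)).
  have p0 : quot_proj I (comm mul x y) = 0.
    rewrite -(linear0 (quot_proj I)); apply/quot_projP.
    by rewrite subr0 comm_in_comm_span.
  congr (_, _) => //; apply: val_inj; rewrite /= p0 linear0 subr0.
  by congr (comm mul _ _); rewrite addrC subrK.
congr (_, _); rewrite -?quot_mul_proj //; apply: val_inj.
by rewrite /= jprod_section quot_mul_proj.
Qed.

End Extension.

Theorem theorem61 (R : realType) (A : lmodType R[i])
    (mul : {bilinear A -> A -> A}) :
  Aflexible mul -> ABD_algebra mul ->
  exists hI : two_sided_ideal (jprod mul) (comm_span mul),
    is_ABD_extension (quot_mul hI) mul.
Proof.
move=> flex ABD; have two_neq0 : 2 != 0 :> R[i] by rewrite Num.Theory.pnatr_eq0.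
have hI : two_sided_ideal (jprod mul) (comm_span mul).
  (* All products in A^+ with an element of (A^-)^2 are 0, so the ideal property is immediate. *)
  move=> a x /(jprod_comm_span two_neq0 flex ABD) a0.
  by rewrite (jprodC mul x) a0 rpred0.
have [|s sK] := @linear_section _ _ _ (quot_proj (comm_span mul)).
  by move=> u; exists (quot_repr u); apply: quot_reprK.
exists hI; split; first exact: (quot_jacobi_jordan hI sK).
exists (subspace (comm_span mul)), (ext_cocycle hI sK), (ext_bracket s).
split; first exact: ext_cocycleP.
  exact: ext_bracketP.
exists (ext_iso sK); split; first exact: ext_iso_bij.
exact: ext_iso_mul.
Qed.
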